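(* Let $M\in\mathbb{R}^{n\times n}$ and $M'\in\mathbb{R}^{n'\times n'}$ be irreducible nonnegative matrices with $M\mathbf{1}_n=\rho\mathbf{1}_n$ and $M'\mathbf{1}_{n'}=\rho'\mathbf{1}_{n'}$ for some $\rho,\rho'\ge 0$, and let $P=M\otimes\mathbb{J}_{n'}+\mathbb{J}_n\otimes M'$. Let $\{\mathbf{v}_1=\mathbf{1}_n,\mathbf{v}_2,\dots,\mathbf{v}_k\}$ be a linearly independent set of eigenvectors of $M$ with $M\mathbf{v}_i=\lambda_i\mathbf{v}_i$, and let $\{\mathbf{v}'_1=\mathbf{1}_{n'},\mathbf{v}'_2,\dots,\mathbf{v}'_{k'}\}$ be a linearly independent set of eigenvectors of $M'$ with $M'\mathbf{v}'_j=\lambda'_j\mathbf{v}'_j$. Then: (1) $\mathbf{1}_n\otimes\mathbf{1}_{n'}$ is an eigenvector of $P$ corresponding to the spectral radius of $P$, which is $n\rho'+n'\rho$. (2) For $i=2,\dots,k$, the vector $\mathbf{v}_i\otimes\mathbf{1}_{n'}+\gamma_i\,\mathbf{1}_n\otimes\mathbf{1}_{n'}$, where $\gamma_i=\dfrac{\mathbf{v}_i^T\mathbf{1}_n\,\rho'}{n'\lambda_i-n'\rho-n\rho'}$, is an eigenvector of $P$ corresponding to the eigenvalue $n'\lambda_i$. (3) For $j=2,\dots,k'$, the vector $\mathbf{1}_n\otimes\mathbf{v}'_j+\gamma'_j\,\mathbf{1}_n\otimes\mathbf{1}_{n'}$, where $\gamma'_j=\dfrac{\mathbf{v}_j'^T\mathbf{1}_{n'}\,\rho}{n\lambda'_j-n\rho'-n'\rho}$,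 is an eigenvector of $P$ corresponding to the eigenvalue $n\lambda'_j$. (4) Let $\{\mathbf{z}_1,\dots,\mathbf{z}_{n-1}\}$, respectively $\{\mathbf{z}'_1,\dots,\mathbf{z}'_{n'-1}\}$, be a linearly independent set of null vectors of $\mathbb{J}_n$, respectively $\mathbb{J}_{n'}$. Then for $i=1,\dots,n-1$ and $j=1,\dots,n'-1$, $\mathbf{z}_i\otimes\mathbf{z}'_j$ is a null vector of $P$. Furthermore, the set of eigenvectors of $P$ described in (1)–(4) is linearly independent. If $\{\mathbf{v}_1=\mathbf{1}_n,\mathbf{v}_2,\dots,\mathbf{v}_n\}$ and $\{\mathbf{v}'_1=\mathbf{1}_{n'},\mathbf{v}'_2,\dots,\mathbf{v}'_{n'}\}$ are bases of eigenvectors for $M$ and $M'$, then the set of eigenvectors of $P$ described in (1)–(4) is a basis of eigenvectors.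
   Context: $\mathbf{1}_n$ is the all-ones vector of length $n$, $\mathbb{J}_n$ is the $n\times n$ all-ones matrix, and $\otimes$ is the Kronecker product. Eigenvectors may be complex; $^T$ denotes transpose (no conjugation). *)

(* Defs.v *)
From HB Require Import structures.
From mathcomp Require Import all_boot all_order all_algebra all_fingroup.
From mathcomp Require Import reals.
From mathcomp Require Export complex mxtens.

Set Implicit Arguments.
Unset Strict Implicit.
Unset Printing Implicit Defensive.

Import Order.TTheory GRing.Theory Num.Theory.
Local Open Scope ring_scope.
Local Open Scope complex_scope.

Definition ones (K : nzRingType) (n : nat) : 'cV[K]_n := const_mx 1.
Arguments ones {K} n.

Definition allones (K : nzRingType) (n : nat) : 'M[K]_n := const_mx 1.
Arguments allones {K} n.

(* The Kronecker product [u *t v] of two columns has [1 * 1] columns; the type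
   ascription (by conversion) makes it a column again. *)
Definition kronv (K : nzRingType) (m n : nat) (u : 'cV[K]_m) (v : 'cV[K]_n) :
  'cV[K]_(m * n) := u *t v.

Definition complex_mx (R : realType) (m n : nat) (A : 'M[R]_(m, n)) :
  'M[R[i]]_(m, n) := map_mx (real_complex R) A.

Definition nonneg_mx (R : realType) (n : nat) (A : 'M[R]_n) : Prop :=
  forall i j, 0 <= A i j.

(* A simultaneous permutation of rows and columns puts [A] in block upper
   triangular form, with diagonal blocks of sizes [r] and [n - r], both
   positive. Under this convention every 1 x 1 matrix is irreducible. *)
Definition reducible_mx (K : nzRingType) (n : nat) (A : 'M[K]_n) : Prop :=
  exists (s : 'S_n) (r : nat), (0 < r < n)%N /\
    forall i j : 'I_n, (r <= i)%N -> (j < r)%N -> row_perm s (col_perm s A) i j = 0.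

Definition irreducible_mx (K : nzRingType) (n : nat) (A : 'M[K]_n) : Prop :=
  ~ reducible_mx A.

(* Right eigenvectors, whereas MathComp's [eigenspace] consists of row vectors. *)
Definition is_eigenvector (K : fieldType) (n : nat) (A : 'M[K]_n) (a : K)
  (v : 'cV[K]_n) : Prop := v != 0 /\ A *m v = a *: v.

Definition is_null_vector (K : fieldType) (n : nat) (A : 'M[K]_n)
  (v : 'cV[K]_n) : Prop := v != 0 /\ A *m v = 0.

(* [r] is the largest modulus of a complex eigenvalue of [A]. *)
Definition is_spectral_radius (R : realType) (n : nat) (A : 'M[R]_n) (r : R) :
  Prop :=
  (exists a v, is_eigenvector (complex_mx A) a v /\ `|a| = r%:C) /\
  (forall a v, is_eigenvector (complex_mx A) a v -> `|a| <= r%:C).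

Section ProductEigenvectors.

Variables (R : realType) (n n' : nat).

Definition kron_sum (M : 'M[R]_n) (M' : 'M[R]_n') : 'M[R]_(n * n') :=
  M *t allones n' + allones n *t M'.

Definition gamma_den (rho rho' : R) (a : R[i]) : R[i] :=
  n'%:R * a - n'%:R * rho%:C - n%:R * rho'%:C.

Definition gamma_coef (rho rho' : R) (a : R[i]) (v : 'cV[R[i]]_n) : R[i] :=
  (v^T *m ones n) 0 0 * rho'%:C / gamma_den rho rho' a.

Definition gamma_den' (rho rho' : R) (a' : R[i]) : R[i] :=
  n%:R * a' - n%:R * rho'%:C - n'%:R * rho%:C.

Definition gamma_coef' (rho rho' : R) (a' : R[i]) (v' : 'cV[R[i]]_n') : R[i] :=
  (v'^T *m ones n') 0 0 * rho%:C / gamma_den' rho rho' a'.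

Definition lift_left (rho rho' : R) (a : R[i]) (v : 'cV[R[i]]_n) :
  'cV[R[i]]_(n * n') :=
  kronv v (ones n') + gamma_coef rho rho' a v *: kronv (ones n) (ones n').

Definition lift_right (rho rho' : R) (a' : R[i]) (v' : 'cV[R[i]]_n') :
  'cV[R[i]]_(n * n') :=
  kronv (ones n) v' + gamma_coef' rho rho' a' v' *: kronv (ones n) (ones n').

(* The families [v] and [v'] start with the all-ones vector at index [ord0],
   which is left out of the second and third groups. *)
Definition product_eigenvectors (rho rho' : R) (k k' : nat)
    (lam : 'I_k.+1 -> R[i]) (v : 'I_k.+1 -> 'cV[R[i]]_n)
    (lam' : 'I_k'.+1 -> R[i]) (v' : 'I_k'.+1 -> 'cV[R[i]]_n')
    (z : 'I_n.-1 -> 'cV[R[i]]_n) (z' : 'I_n'.-1 -> 'cV[R[i]]_n') :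
    seq 'cV[R[i]]_(n * n') :=
  kronv (ones n) (ones n')
  :: [seq lift_left rho rho' (lam (lift ord0 i)) (v (lift ord0 i)) | i : 'I_k]
  ++ [seq lift_right rho rho' (lam' (lift ord0 j)) (v' (lift ord0 j))
     | j : 'I_k']
  ++ [seq kronv (z i) (z' j) | i <- enum 'I_n.-1, j <- enum 'I_n'.-1].

End ProductEigenvectors.

(* Main.v *)
From HB Require Import structures.
Require Import Defs.
From mathcomp Require Import all_boot all_order all_algebra all_fingroup.
From mathcomp Require Import reals complex mxtens.

Set Implicit Arguments.
Unset Strict Implicit.
Unset Printing Implicit Defensive.

Import Order.TTheory GRing.Theory Num.Theory.
Local Open Scope ring_scope.
Local Open Scope complex_scope.

(** Write 1 for an all-ones column, J for an all-ones matrix, and s(u) for the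
    sum of the entries of u, so that J u = s(u) 1. Everything about eigenvectors
    follows from
    [P (u ⊗ w) = s(w) (M u ⊗ 1) + s(u) (1 ⊗ M' w)]   ([kron_sum_kronv]).

    With u = w = 1 this says that P has constant row sums n rho' + n' rho, and a
    constant row sum of a nonnegative matrix is its spectral radius
    ([spectral_radius_row_sum]). When u and w have entry sum 0 it gives a null
    vector. When M u = a u and w = 1 it gives
    P (u ⊗ 1) = n' a (u ⊗ 1) + s(u) rho' (1 ⊗ 1): since 1 ⊗ 1 is itself an
    eigenvector, a multiple of it corrects u ⊗ 1 into an eigenvector for n' a, as
    soon as n' a differs from the eigenvalue n' rho + n rho' of 1 ⊗ 1
    ([shifted_eigenvector]).

    Irreducibility is what guarantees that they differ ([gamma_den_neq0]). As
    |a| <= rho, equality would force a = rho, and by the maximum principle the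
    eigenspace of an irreducible M for its row sum rho is the line of 1
    ([irreducible_fixed_line]), whereas u is independent of 1.

    Independence is shown with linear maps that kill all but one of the groups
    of vectors. Let C = J - n I, whose kernel is the line of 1. Then C ⊗ 1^T sees
    only the vectors lifted from the left factor, 1^T ⊗ C only those lifted from
    the right factor, and once these are removed 1^T ⊗ 1^T separates 1 ⊗ 1 from
    the z_i ⊗ z'_j, which are independent as products of independent families
    ([free_kronv]). So the groups split off one
    at a time ([free_cat_map]). When M and M' have eigenbases, the number of
    vectors is 1 + (n - 1) + (n' - 1) + (n - 1)(n' - 1) = n n', so the
    independent family is a basis. *)

(** * Independent families and linear maps *)

Section LinearIndependence.
Variables (K : fieldType) (V W : vectType K).

Lemma free_map_inj (f : V -> W) (X : seq V) : linear f -> free X ->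
  {in <<X>>%VS, forall u, f u = 0 -> u = 0} -> free (map f X).
Proof.
move=> f_lin freeX f_inj.
pose fL : {linear V -> W} := HB.pack f (GRing.isLinear.Build _ _ _ _ f f_lin).
rewrite -(@eq_map _ _ (linfun fL)) => [|u]; last by rewrite lfunE.
apply: (@basis_free _ _ (linfun fL @: <<X>>)%VS).
apply: limg_basis_of; last by rewrite /basis_of eqxx.
apply/eqP; rewrite -subv0; apply/subvP => u.
rewrite memv_cap memv_ker lfunE memv0 => /andP[uX /eqP fu0].
by apply/eqP/f_inj.
Qed.

(** The line of [e] meets the span of [X] only in 0, so a map whose kernel lies
    in that line is injective on the span of [X]. *)
Lemma free_map_modulo_line (f : V -> W) (e : V) (X : seq V) : linear f ->
  (forall u, f u = 0 -> u \in <[e]>%VS) -> free (e :: X) -> free (map f X).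
Proof.
move=> f_lin ker_f; rewrite free_cons => /andP[eX freeX].
apply: free_map_inj => // u uX /ker_f/vlineP[c u_eq].
have [c0|c_neq0] := eqVneq c 0; first by rewrite u_eq c0 scale0r.
by case/negP: eX; rewrite -(scalerK c_neq0 e) -u_eq memvZ.
Qed.

(** A vanishing combination of [X ++ Y] is mapped by [f] to one of [map f X], so
    its coefficients on [X] are 0 and only [Y] remains. *)
Lemma free_cat_map (f : V -> W) (X Y : seq V) : linear f ->
  {in Y, forall y, f y = 0} -> free (map f X) -> free Y -> free (X ++ Y).
Proof.
move=> f_lin fY0 + freeY.
pose fL : {linear V -> W} := HB.pack f (GRing.isLinear.Build _ _ _ _ f f_lin).
have mapE Z : map f Z = map (linfun fL) Z by apply: eq_map => u; rewrite lfunE.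
elim: X => //= x X IH; rewrite !free_cons => /andP[fxX /IH ->].
rewrite andbT; apply: contra fxX => /(memv_img (linfun fL)).
rewrite limg_span lfunE map_cat mapE span_cat; apply: subvP.
rewrite subv_add subvv; apply/span_subvP => _ /mapP[y /fY0 fy0 ->].
by rewrite lfunE /= fy0 mem0v.
Qed.

End LinearIndependence.

Lemma free_cons_notin_line (K : fieldType) (V : vectType K) (e x : V)
    (X : seq V) : free (e :: X) -> x \in X -> x \notin <[e]>%VS.
Proof.
rewrite free_cons => /andP[eX freeX] xX; apply: contra eX => /vlineP[c x_eq].
have c_neq0 : c != 0.
  by apply: contraNneq (free_not0 freeX xX) => c0; rewrite x_eq c0 scale0r.
by rewrite -(scalerK c_neq0 e) -x_eq memvZ // memv_span.
Qed.

Lemma image_ord_recl (T : Type) (m : nat) (F : 'I_m.+1 -> T) :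
  [seq F i | i : 'I_m.+1] = F ord0 :: [seq F (lift ord0 i) | i : 'I_m].
Proof. by rewrite /image_mem enum_ordSl /= -map_comp. Qed.

(** One member of a dual family, as a row so that it can be tensored with
    another matrix. *)
Lemma exists_dual_row (K : fieldType) (n : nat) (e : 'cV[K]_n)
    (X : seq 'cV[K]_n) :
  free (e :: X) ->
  exists phi : 'rV[K]_n, phi *m e = 1%:M /\ {in X, forall x, phi *m x = 0}.
Proof.
move=> freeX.
have [f /(_ freeX) fE] := linear_of_free (e :: X) ((1 : K^o) :: nseq (size X) 0).
have phiE u : (\row_j f (delta_mx j 0)) *m u = (f u)%:M.
  apply/matrixP=> i j; rewrite !ord1 [in RHS](matrix_sum_delta u) linear_sum.
  rewrite !mxE mulr1n; apply: eq_bigr => k _.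
  by rewrite big_ord1 linearZ mxE mulrC.
exists (\row_j f (delta_mx j 0)).
move: fE; rewrite /= size_nseq => /(_ erefl)[fe fX]; split.
  by rewrite phiE fe.
move=> x xX; rewrite phiE.
have /nseqP[-> _] : f x \in nseq (size X) (0 : K^o) by rewrite -fX map_f.
by rewrite raddf0.
Qed.

(** * Kronecker products of columns *)

Section Kronv.
Variable K : fieldType.
Implicit Types m n : nat.

Lemma kronvE m n (u : 'cV[K]_m) (w : 'cV[K]_n) i j :
  kronv u w (mxtens_index (i, j)) 0 = u i 0 * w j 0.
Proof. by rewrite mxE mxtens_indexK !ord1. Qed.

Lemma mulmx_kronv m n p q (A : 'M[K]_(p, m)) (B : 'M[K]_(q, n)) u w :
  (A *t B) *m kronv u w = kronv (A *m u) (B *m w).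
Proof. exact: (tensmx_mul (r := 1) (s := 1)). Qed.

Lemma kronv0l m n (w : 'cV[K]_n) : kronv (0 : 'cV_m) w = 0.
Proof. exact: (tens0mx (n := 1) (q := 1)). Qed.

Lemma kronv0r m n (u : 'cV[K]_m) : kronv u (0 : 'cV_n) = 0.
Proof. exact: (tensmx0 (n := 1) (q := 1)). Qed.

Lemma kronv_eq0 m n (u : 'cV[K]_m) (w : 'cV[K]_n) :
  (kronv u w == 0) = (u == 0) || (w == 0).
Proof.
apply/eqP/orP => [uw0|[]/eqP->]; last 2 first.
- exact: kronv0l.
- exact: kronv0r.
have [_|/cV0Pn[i ui]] := eqVneq u 0; [by left | right].
apply/eqP/colP=> j; have /eqP := kronvE u w i j.
by rewrite uw0 !mxE eq_sym mulf_eq0 (negPf ui) => /eqP.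
Qed.

Lemma kronvZl m n c (u : 'cV[K]_m) (w : 'cV[K]_n) :
  kronv (c *: u) w = c *: kronv u w.
Proof.
apply/colP=> k; case: (mxtens_indexP k) => i j {k}.
by rewrite !mxE !mxtens_indexK mulrA.
Qed.

Lemma kronvZr m n c (u : 'cV[K]_m) (w : 'cV[K]_n) :
  kronv u (c *: w) = c *: kronv u w.
Proof.
apply/colP=> k; case: (mxtens_indexP k) => i j {k}.
by rewrite !mxE !mxtens_indexK mulrCA.
Qed.

Lemma kronvDl m n (u1 u2 : 'cV[K]_m) (w : 'cV[K]_n) :
  kronv (u1 + u2) w = kronv u1 w + kronv u2 w.
Proof.
apply/colP=> k; case: (mxtens_indexP k) => i j {k}.
by rewrite !mxE !mxtens_indexK mulrDl.
Qed.

Lemma kronvDr m n (u : 'cV[K]_m) (w1 w2 : 'cV[K]_n) :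
  kronv u (w1 + w2) = kronv u w1 + kronv u w2.
Proof.
apply/colP=> k; case: (mxtens_indexP k) => i j {k}.
by rewrite !mxE !mxtens_indexK mulrDr.
Qed.

Lemma kronv_linear_r m n (u : 'cV[K]_m) : linear (@kronv K m n u).
Proof. by move=> c w1 w2; rewrite kronvDr kronvZr. Qed.

Lemma kronv_linear_l m n (w : 'cV[K]_n) : linear ((@kronv K m n)^~ w).
Proof. by move=> c u1 u2; rewrite kronvDl kronvZl. Qed.

(** Induction on [X]: a row [phi] with [phi u = 1] that kills the rest of [X]
    turns [phi ⊗ I] into a map that recovers [w] from [u ⊗ w] and kills all the
    other products. *)
Lemma free_kronv m n (X : seq 'cV[K]_m) (Y : seq 'cV[K]_n) :
  free X -> free Y -> free [seq kronv u w | u <- X, w <- Y].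
Proof.
move=> + freeY; elim: X => [|u X IH] freeX; first exact: nil_free.
have [phi [phi_u phi_X]] := exists_dual_row freeX.
have freeX' : free X by move: freeX; rewrite free_cons => /andP[].
rewrite allpairs_cons.
apply: (@free_cat_map _ _ _ (mulmx (phi *t 1%:M))) => [||| /[!IH] //].
- exact: linearP.
- move=> _ /allpairsP[[x y] /= [/phi_X phi_x _ ->]].
  by rewrite mulmx_kronv phi_x kronv0l.
rewrite -map_comp (eq_map (g := kronv (1%:M : 'cV[K]_1))); last first.
  by move=> w /=; rewrite mulmx_kronv phi_u mul1mx.
apply: free_map_inj => //; first exact: kronv_linear_r.
by move=> w _ /eqP; rewrite kronv_eq0 (negPf (matrix_nonzero1 _ _)) => /eqP.
Qed.

End Kronv.

(** * Irreducible matrices *)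

(** List the complement of [S] first and [S] last: in this order the vanishing
    entries, with row in [S] and column outside, fill the lower left block. *)
Lemma reducible_of_closed (K : nzRingType) (n : nat) (A : 'M[K]_n)
    (S : {set 'I_n}) : S != set0 -> S != setT ->
  (forall i j, i \in S -> j \notin S -> A i j = 0) -> reducible_mx A.
Proof.
move=> S_neq0 S_neqT S_closed.
pose T := enum (~: S) ++ enum S.
have sizeT : size T = n.
  by rewrite size_cat -!cardE addnC cardsC card_ord.
have uniqT : uniq T.
  rewrite cat_uniq !enum_uniq andbT /=; apply/hasPn => i.
  by rewrite !mem_enum inE negbK.
(* [T] has size [n], so the default is never reached; [i] is at hand, while
   ['I_n] has no canonical inhabitant. *)
pose f (i : 'I_n) := nth i T i.
have f_inj : injective f.
  move=> i j /eqP; rewrite /f (set_nth_default i j) ?sizeT //.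
  by rewrite nth_uniq ?sizeT // => /eqP/val_inj.
exists (perm f_inj), #|~: S|; split.
  apply/andP; split.
    rewrite lt0n cards_eq0; apply: contra S_neqT => /eqP SC0.
    by rewrite -[S]setCK SC0 setC0.
  by rewrite -[X in (_ < X)%N](card_ord n) -(cardsC S) -[X in (X < _)%N]add0n
             ltn_add2r lt0n cards_eq0.
move=> i j le_i lt_j; rewrite !mxE !permE; apply: S_closed.
  rewrite /f nth_cat -cardE ltnNge le_i /= -mem_enum mem_nth // -cardE.
  by rewrite ltn_subLR // addnC cardsC card_ord.
have : f j \in ~: S by rewrite /f nth_cat -cardE lt_j -mem_enum mem_nth // -cardE.
by rewrite inE.
Qed.

(** * The all-ones vector *)

Section AllOnes.
Variables (K : fieldType) (n : nat).
Implicit Type u : 'cV[K]_n.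

Lemma allones_mul u : allones n *m u = (u^T *m ones n) 0 0 *: ones n.
Proof.
apply/colP=> i; rewrite !mxE mulr1; apply: eq_bigr => j _.
by rewrite !mxE mulr1 mul1r.
Qed.

Lemma ones_tr_mul u : (ones n)^T *m u = ((u^T *m ones n) 0 0)%:M.
Proof.
apply/matrixP=> i j; rewrite !ord1 !mxE mulr1n; apply: eq_bigr => k _.
by rewrite !mxE mulrC.
Qed.

Lemma sum_ones : ((ones n)^T *m ones n) 0 0 = n%:R :> K.
Proof.
rewrite mxE -[n in n%:R]card_ord -sumr_const.
by apply: eq_bigr => i _; rewrite !mxE mulr1.
Qed.

Lemma ones_neq0 : (0 < n)%N -> ones n != 0 :> 'cV[K]_n.
Proof. by move=> n0; apply/cV0Pn; exists (Ordinal n0); rewrite mxE oner_eq0. Qed.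

Lemma sum_allones_null u : (0 < n)%N -> allones n *m u = 0 -> (u^T *m ones n) 0 0 = 0.
Proof.
move=> n0; rewrite allones_mul => /eqP.
by rewrite scaler_eq0 (negPf (ones_neq0 n0)) orbF => /eqP.
Qed.

(** Up to the factor [-n], the projection onto the columns with entry sum 0 along
    the line of the all-ones vector. *)
Definition centering : 'M[K]_n := allones n - n%:R%:M.

Lemma centering_ones : centering *m ones n = 0.
Proof. by rewrite mulmxBl allones_mul sum_ones mul_scalar_mx subrr. Qed.

Lemma centering_ker u : n%:R != 0 :> K -> centering *m u = 0 ->
  u \in <[ones n]>%VS.
Proof.
move=> n_neq0 /eqP; rewrite mulmxBl allones_mul mul_scalar_mx subr_eq0 => /eqP uE.
by rewrite -[u](scalerK n_neq0) -uE !memvZ // memv_line.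
Qed.

End AllOnes.
Arguments centering {K} n.

Lemma complex_ones (R : realType) (m : nat) :
  complex_mx (ones m) = ones m :> 'cV[R[i]]_m.
Proof. by apply/matrixP=> i j; rewrite !mxE rmorph1. Qed.

Lemma complex_eigen_ones (R : realType) (m : nat) (A : 'M[R]_m) (r : R) :
  A *m ones m = r *: ones m -> complex_mx A *m ones m = r%:C *: ones m.
Proof. by move=> A1; rewrite -complex_ones /complex_mx -map_mxM A1 map_mxZ. Qed.

Lemma kronv_ones (K : fieldType) (m n : nat) :
  kronv (ones m) (ones n) = ones (m * n) :> 'cV[K]_(m * n).
Proof. by apply/colP=> k; rewrite !mxE mulr1. Qed.

Lemma shift_line_neq0 (K : fieldType) (m : nat) (u : 'cV[K]_m) (c : K) :
  u \notin <[ones m]>%VS -> u + c *: ones m != 0.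
Proof.
by apply: contra; rewrite addr_eq0 => /eqP->; rewrite memvN memvZ ?memv_line.
Qed.

(** On the plane of [x] and [e], [A] is triangular with eigenvalues [b] and [r];
    as they differ, [x] can be corrected by a multiple of [e]. *)
Lemma shifted_eigenvector (K : fieldType) (m : nat) (A : 'M[K]_m) (b r d : K)
    (x e : 'cV[K]_m) : A *m x = b *: x + d *: e -> A *m e = r *: e ->
  b - r != 0 ->
  A *m (x + (d / (b - r)) *: e) = b *: (x + (d / (b - r)) *: e).
Proof.
move=> Ax Ae br; rewrite mulmxDr -scalemxAr Ax Ae !scalerDr !scalerA -addrA.
rewrite -scalerDl; congr (_ + _ *: _).
by rewrite -{1}(divfK br d) -mulrDr subrK mulrC.
Qed.

(** * Nonnegative matrices with constant row sums *)

Section Irreducible.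

Variables (R : realType) (n : nat) (A : 'M[R]_n) (rho : R).
Hypotheses (n_gt0 : (0 < n)%N) (A_ge0 : nonneg_mx A).
Hypothesis A1 : A *m ones n = rho *: ones n.

Lemma row_sum i : \sum_j A i j = rho.
Proof.
move/colP/(_ i): A1; rewrite !mxE mulr1 => <-.
by apply: eq_bigr => j _; rewrite mxE mulr1.
Qed.

(** Look at an entry of [v] of largest modulus: the corresponding row of
    [A v = a v] expresses [a] times it as a combination with nonnegative weights,
    of total [rho], of entries that are no larger. *)
Lemma eigenvalue_le_row_sum a v :
  is_eigenvector (complex_mx A) a v -> `|a| <= rho%:C.
Proof.
case=> v_neq0 Av.
(* The order on [R[i]] is partial, so the maximum is taken over real numbers. *)
pose N i := complex.Re `|v i 0|.
have NE i : `|v i 0| = (N i)%:C by rewrite RRe_real ?normr_real.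
have [i _ i_max] :=
  @Order.TotalTheory.arg_maxP _ R 'I_n (Ordinal n_gt0) predT N isT.
have vi_gt0 : 0 < `|v i 0|.
  have /cV0Pn[j vj] := v_neq0.
  rewrite (lt_le_trans (_ : 0 < `|v j 0|)) ?normr_gt0 //.
  by rewrite !NE lecR; apply: i_max.
rewrite -(ler_pM2r vi_gt0) -normrM.
have -> : a * v i 0 = \sum_j (A i j)%:C * v j 0.
  move/colP/(_ i): Av; rewrite [RHS]mxE => <-; rewrite mxE.
  by apply: eq_bigr => j _; rewrite mxE.
rewrite -(row_sum i) rmorph_sum mulr_suml.
apply: le_trans (ler_norm_sum _ _ _) _; apply: ler_sum => j _.
rewrite normrM ger0_norm ?ler0c // ler_wpM2l ?ler0c //.
by rewrite !NE lecR; apply: i_max.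
Qed.

Lemma spectral_radius_row_sum : is_spectral_radius A rho.
Proof.
split; last by move=> a v; apply: eigenvalue_le_row_sum.
exists rho%:C, (ones n); split; last first.
  by rewrite ger0_norm // ler0c -(row_sum (Ordinal n_gt0)) sumr_ge0.
split; first exact: ones_neq0.
exact: complex_eigen_ones.
Qed.

Hypothesis A_irr : irreducible_mx A.

(** Maximum principle: at an index [p] where [x] is maximal, the terms
    [A p j (x p - x j)] are nonnegative with sum 0, so [A p j = 0] wherever [x j]
    is smaller. The set of maximal indices is thus closed, hence everything. *)
Lemma irreducible_fixed_const (x : 'cV[R]_n) : A *m x = rho *: x ->
  forall i j, x i 0 = x j 0.
Proof.
move=> Ax.
have [m _ m_max] :=
  @Order.TotalTheory.arg_maxP _ R 'I_n (Ordinal n_gt0) predT (x^~ 0) isT.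
suff max_eq i : x i 0 = x m 0 by move=> i j; rewrite !max_eq.
apply/eqP/negPn/negP => xi; apply: A_irr.
apply: (@reducible_of_closed _ _ _ [set j | x j 0 == x m 0]).
- by apply/set0Pn; exists m; rewrite inE.
- by apply/negP => /eqP/setP/(_ i); rewrite !inE (negPf xi).
move=> p q; rewrite !inE => /eqP xp xq.
have /psumr_eq0P H : forall j, true -> 0 <= A p j * (x p 0 - x j 0).
  by move=> j _; rewrite mulr_ge0 // subr_ge0 xp; apply: m_max.
have /H/(_ q isT)/eqP : \sum_j A p j * (x p 0 - x j 0) = 0.
  under eq_bigr do rewrite mulrBr.
  rewrite sumrB -mulr_suml row_sum.
  by move/colP/(_ p): Ax; rewrite !mxE => ->; rewrite subrr.
by rewrite mulf_eq0 subr_eq0 xp [x m 0 == _]eq_sym (negPf xq) orbF => /eqP.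
Qed.

(** [A] and [rho] are real, so the real and imaginary parts of [u] are fixed as
    well, and the maximum principle applies to each. *)
Lemma irreducible_fixed_line (u : 'cV[R[i]]_n) : complex_mx A *m u = rho%:C *: u ->
  u \in <[ones n]>%VS.
Proof.
move=> Au.
have AuE i : \sum_j (A i j)%:C * u j 0 = rho%:C * u i 0.
  move/colP/(_ i): Au; rewrite [RHS]mxE => <-; rewrite mxE.
  by apply: eq_bigr => j _; rewrite mxE.
pose i0 := Ordinal n_gt0.
have Re_const := @irreducible_fixed_const (\col_i complex.Re (u i 0)).
have Im_const := @irreducible_fixed_const (\col_i complex.Im (u i 0)).
have ReD : {morph @complex.Re R : x y / x + y} by case=> ? ? [].
have ImD : {morph @complex.Im R : x y / x + y} by case=> ? ? [].
have ReZ c (x : R[i]) : complex.Re (c%:C * x) = c * complex.Re x.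
  by case: x => ? ?; rewrite /= mul0r subr0.
have ImZ c (x : R[i]) : complex.Im (c%:C * x) = c * complex.Im x.
  by case: x => ? ?; rewrite /= mul0r addr0.
have uE i : u i 0 = u i0 0.
  rewrite [LHS]complexE [RHS]complexE.
  have -> : complex.Re (u i 0) = complex.Re (u i0 0).
    have := Re_const _ i i0; rewrite !mxE; apply.
    apply/colP=> j; rewrite !mxE -ReZ -AuE (big_morph _ ReD erefl).
    by apply: eq_bigr => k _; rewrite mxE ReZ.
  have -> // : complex.Im (u i 0) = complex.Im (u i0 0).
  have := Im_const _ i i0; rewrite !mxE; apply.
  apply/colP=> j; rewrite !mxE -ImZ -AuE (big_morph _ ImD erefl).
  by apply: eq_bigr => k _; rewrite mxE ImZ.
apply/vlineP; exists (u i0 0); apply/colP => i.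
by rewrite !mxE mulr1 uE.
Qed.

(** If the denominator vanished, [a] would be [rho + n sigma / m]; the bound
    [|a| <= rho] leaves only [a = rho], whose eigenvectors are multiples of the
    all-ones vector. The hypothesis on [u] is what excludes that case, which does
    occur when [sigma = 0]. *)
Lemma gamma_den_neq0 (m : nat) (sigma : R) (a : R[i]) (u : 'cV[R[i]]_n) :
  (0 < m)%N -> 0 <= sigma -> is_eigenvector (complex_mx A) a u ->
  u \notin <[ones n]>%VS -> gamma_den n m rho sigma a != 0.
Proof.
move=> m_gt0 sigma_ge0 u_eig; apply: contra; rewrite /gamma_den => /eqP den0.
have aE : a = (rho + n%:R * sigma / m%:R)%:C.
  have mC : m%:R != 0 :> R[i] by rewrite pnatr_eq0 -lt0n.
  apply: (mulfI mC); apply/eqP.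
  rewrite rmorphD rmorphM fmorphV rmorphM !rmorph_nat mulrDr mulrCA divff // mulr1.
  by rewrite -subr_eq0 opprD addrA den0.
have /eigenvalue_le_row_sum := u_eig.
have c_ge0 : 0 <= n%:R * sigma / m%:R by rewrite divr_ge0 ?mulr_ge0 ?ler0n.
have rho_ge0 : 0 <= rho by rewrite -(row_sum (Ordinal n_gt0)) sumr_ge0.
rewrite aE ger0_norm ?ler0c ?addr_ge0 // lecR gerDl => c_le0.
have c0 : n%:R * sigma / m%:R = 0 by apply/le_anti; rewrite c_le0.
by case: u_eig => _; rewrite aE c0 addr0 => /irreducible_fixed_line.
Qed.

End Irreducible.

(** * Eigenvectors of the product matrix *)

Section KronSum.
Variables (R : realType) (n n' : nat) (M : 'M[R]_n) (M' : 'M[R]_n').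
Variables (rho rho' : R).
Hypothesis M1 : M *m ones n = rho *: ones n.
Hypothesis M'1 : M' *m ones n' = rho' *: ones n'.
Local Notation P := (kron_sum M M').

(** Both J factors collapse a column to its entry sum times the all-ones vector;
    all the eigenvalue equations below are instances of this one. *)
Lemma kron_sum_kronv (K : fieldType) (A : 'M[K]_n) (A' : 'M[K]_n') u w :
  (A *t allones n' + allones n *t A') *m kronv u w =
  (w^T *m ones n') 0 0 *: kronv (A *m u) (ones n') +
  (u^T *m ones n) 0 0 *: kronv (ones n) (A' *m w).
Proof. by rewrite mulmxDl !mulmx_kronv !allones_mul kronvZl kronvZr. Qed.

Lemma complex_kron_sum : complex_mx P =
  complex_mx M *t allones n' + allones n *t complex_mx M'.
Proof.
rewrite /complex_mx map_mxD !map_mxT.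
by congr (_ *t _ + _ *t _); apply/matrixP=> i j; rewrite !mxE rmorph1.
Qed.

Lemma kron_sum_ones : P *m ones (n * n') =
  (n%:R * rho' + n'%:R * rho) *: ones (n * n').
Proof.
rewrite -!kronv_ones kron_sum_kronv !sum_ones M1 M'1 kronvZl kronvZr !scalerA.
by rewrite -scalerDl addrC.
Qed.

Lemma mulmx_lift_left a u : gamma_den n n' rho rho' a != 0 ->
  complex_mx M *m u = a *: u ->
  complex_mx P *m lift_left n' rho rho' a u =
  (n'%:R * a) *: lift_left n' rho rho' a u.
Proof.
rewrite /lift_left /gamma_coef /gamma_den -addrA -opprD => den Mu.
apply: shifted_eigenvector => //.
  rewrite complex_kron_sum kron_sum_kronv Mu (complex_eigen_ones M'1) sum_ones.
  by rewrite kronvZl kronvZr !scalerA.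
rewrite kronv_ones (complex_eigen_ones kron_sum_ones).
by rewrite rmorphD !rmorphM !rmorph_nat addrC.
Qed.

Lemma mulmx_lift_right a w : gamma_den' n n' rho rho' a != 0 ->
  complex_mx M' *m w = a *: w ->
  complex_mx P *m lift_right n rho rho' a w =
  (n%:R * a) *: lift_right n rho rho' a w.
Proof.
rewrite /lift_right /gamma_coef' /gamma_den' -addrA -opprD => den M'w.
apply: shifted_eigenvector => //.
  rewrite complex_kron_sum kron_sum_kronv M'w (complex_eigen_ones M1) sum_ones.
  by rewrite kronvZl kronvZr !scalerA addrC.
rewrite kronv_ones (complex_eigen_ones kron_sum_ones).
by rewrite rmorphD !rmorphM !rmorph_nat.
Qed.

(** The correction term keeps the vector a pure tensor: this makes it visibly
    nonzero, and easy to contract. *)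
Lemma lift_leftE a u : lift_left n' rho rho' a u =
  kronv (u + gamma_coef n' rho rho' a u *: ones n) (ones n').
Proof. by rewrite kronvDl kronvZl. Qed.

Lemma lift_rightE a w : lift_right n rho rho' a w =
  kronv (ones n) (w + gamma_coef' n rho rho' a w *: ones n').
Proof. by rewrite kronvDr kronvZr. Qed.

Lemma lift_left_eigenvector a u : (0 < n')%N ->
  gamma_den n n' rho rho' a != 0 -> u \notin <[ones n]>%VS ->
  complex_mx M *m u = a *: u ->
  is_eigenvector (complex_mx P) (n'%:R * a) (lift_left n' rho rho' a u).
Proof.
move=> n'_gt0 den u_line Mu; split; last exact: mulmx_lift_left.
by rewrite lift_leftE kronv_eq0 negb_or shift_line_neq0 ?ones_neq0.
Qed.

Lemma lift_right_eigenvector a w : (0 < n)%N ->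
  gamma_den' n n' rho rho' a != 0 -> w \notin <[ones n']>%VS ->
  complex_mx M' *m w = a *: w ->
  is_eigenvector (complex_mx P) (n%:R * a) (lift_right n rho rho' a w).
Proof.
move=> n_gt0 den w_line M'w; split; last exact: mulmx_lift_right.
by rewrite lift_rightE kronv_eq0 negb_or shift_line_neq0 ?ones_neq0.
Qed.

Lemma kron_sum_null u w : (0 < n)%N -> (0 < n')%N ->
  is_null_vector (allones n) u -> is_null_vector (allones n') w ->
  is_null_vector (complex_mx P) (kronv u w).
Proof.
move=> n0 n'0 [u0 Ju] [w0 Jw]; split; first by rewrite kronv_eq0 negb_or u0.
by rewrite complex_kron_sum kron_sum_kronv !sum_allones_null // !scale0r addr0.
Qed.

End KronSum.

(** * Independence of the eigenvectors *)

Section Family.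
Variables (R : realType) (n n' : nat) (rho rho' : R) (k k' : nat).
Variables (lam : 'I_k.+1 -> R[i]) (v : 'I_k.+1 -> 'cV[R[i]]_n).
Variables (lam' : 'I_k'.+1 -> R[i]) (v' : 'I_k'.+1 -> 'cV[R[i]]_n').
Variables (z : 'I_n.-1 -> 'cV[R[i]]_n) (z' : 'I_n'.-1 -> 'cV[R[i]]_n').
Hypotheses (n_gt0 : (0 < n)%N) (n'_gt0 : (0 < n')%N).
Local Notation X := (product_eigenvectors rho rho' lam v lam' v' z z').

Lemma natC_neq0 m : (0 < m)%N -> m%:R != 0 :> R[i].
Proof. by rewrite pnatr_eq0 -lt0n. Qed.

Lemma size_product_eigenvectors : size X = (1 + (k + (k' + n.-1 * n'.-1)))%N.
Proof. by rewrite /= !size_cat size_allpairs !size_image -!cardE !card_ord. Qed.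

(** Three contractions peel off the groups. Centering one factor kills the
    correction terms of the lifted vectors, so the coefficients gamma disappear. *)
Lemma free_product_eigenvectors :
  v ord0 = ones n -> v' ord0 = ones n' ->
  (forall i, allones n *m z i = 0) -> (forall j, allones n' *m z' j = 0) ->
  free [seq v i | i : 'I_k.+1] -> free [seq v' j | j : 'I_k'.+1] ->
  free [seq z i | i : 'I_n.-1] -> free [seq z' j | j : 'I_n'.-1] ->
  free X.
Proof.
rewrite !image_ord_recl => -> -> Jz Jz' v_free v'_free z_free z'_free.
have sum_z i : (ones n)^T *m z i = 0.
  by rewrite ones_tr_mul sum_allones_null // raddf0.
have sum_z' j : (ones n')^T *m z' j = 0.
  by rewrite ones_tr_mul sum_allones_null // raddf0.
have tr_ones m : (ones m)^T *m ones m = m%:R%:M :> 'M[R[i]]_1.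
  by rewrite ones_tr_mul sum_ones.
have nat_scalar_neq0 m : (0 < m)%N -> (m%:R%:M : 'M[R[i]]_1) != 0.
  by move=> m_gt0; apply/cV0Pn; exists 0; rewrite mxE natC_neq0.
rewrite /product_eigenvectors.
set L := [seq lift_left _ _ _ _ _ | i : _].
set L' := [seq lift_right _ _ _ _ _ | i : _].
set Z := [seq kronv _ _ | i <- _, j <- _].
have ZP y : y \in Z -> exists i j, y = kronv (z i) (z' j).
  by case/allpairsP=> -[i j] [_ _ ->]; exists i, j.
have -> : kronv (ones n) (ones n') :: L ++ L' ++ Z =
          [:: kronv (ones n) (ones n')] ++ (L ++ L') ++ Z by rewrite -catA.
rewrite (perm_free (Y := L ++ L' ++ [:: kronv (ones n) (ones n')] ++ Z)); last first.
  by rewrite perm_catCA -catA.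
(* [C ⊗ 1^T] maps the lift of [v i] to [n' C (v i)]. *)
apply: (@free_cat_map _ _ _ (mulmx (centering n *t (ones n')^T))).
- exact: linearP.
- move=> y; rewrite !mem_cat inE => /or3P[/imageP[j _ ->]|/eqP->|/ZP[i [j ->]]].
  + by rewrite lift_rightE mulmx_kronv centering_ones kronv0l.
  + by rewrite mulmx_kronv centering_ones kronv0l.
  + by rewrite mulmx_kronv sum_z' kronv0r.
- rewrite /L /image_mem -map_comp.
  rewrite (eq_map (g := (fun u => kronv (centering n *m u) (n'%:R%:M : 'cV_1)) \o
                        (v \o lift ord0))); last first.
    move=> i /=; rewrite lift_leftE mulmx_kronv tr_ones mulmxDr.
    by rewrite -scalemxAr centering_ones scaler0 addr0.
  rewrite map_comp; apply: free_map_modulo_line v_free.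
    by move=> c u1 u2; rewrite linearP kronv_linear_l.
  move=> u /eqP; rewrite kronv_eq0 (negPf (nat_scalar_neq0 _ n'_gt0)) orbF => /eqP.
  by apply: centering_ker; apply: natC_neq0.
(* [1^T ⊗ C] maps the lift of [v' j] to [n C (v' j)]. *)
apply: (@free_cat_map _ _ _ (mulmx ((ones n)^T *t centering n'))).
- exact: linearP.
- move=> y; rewrite !mem_cat inE => /orP[/eqP->|/ZP[i [j ->]]].
  + by rewrite mulmx_kronv centering_ones kronv0r.
  + by rewrite mulmx_kronv sum_z kronv0l.
- rewrite /L' /image_mem -map_comp.
  rewrite (eq_map (g := (fun w => kronv (n%:R%:M : 'cV_1) (centering n' *m w)) \o
                        (v' \o lift ord0))); last first.
    move=> i /=; rewrite lift_rightE mulmx_kronv tr_ones mulmxDr.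
    by rewrite -scalemxAr centering_ones scaler0 addr0.
  rewrite map_comp; apply: free_map_modulo_line v'_free.
    by move=> c u1 u2; rewrite linearP kronv_linear_r.
  move=> u /eqP; rewrite kronv_eq0 (negPf (nat_scalar_neq0 _ n_gt0)) => /eqP.
  by apply: centering_ker; apply: natC_neq0.
(* [1^T ⊗ 1^T] maps [1 ⊗ 1] to [n n']. *)
apply: (@free_cat_map _ _ _ (mulmx ((ones n)^T *t (ones n')^T))).
- exact: linearP.
- by move=> y /ZP[i [j ->]]; rewrite mulmx_kronv sum_z kronv0l.
- rewrite /= seq1_free mulmx_kronv !tr_ones kronv_eq0 negb_or.
  by rewrite !nat_scalar_neq0.
have := free_kronv z_free z'_free.
by rewrite allpairs_mapl allpairs_mapr.
Qed.

(** Eigenbases of [M] and [M'] give [k = n - 1] and [k' = n' - 1], and then the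
    independent family has as many vectors as the dimension. *)
Lemma basis_product_eigenvectors :
  basis_of fullv [seq v i | i : 'I_k.+1] ->
  basis_of fullv [seq v' j | j : 'I_k'.+1] ->
  free X -> basis_of fullv X.
Proof.
have sizeE m l (F : 'I_l.+1 -> 'cV[R[i]]_m) :
    basis_of fullv [seq F i | i : 'I_l.+1] -> l = m.-1.
  case/andP=> /eqP spanF /eqP; rewrite spanF dimvf dim_matrix mulr1.
  by rewrite size_image card_ord => -> /=.
move=> /sizeE k_eq /sizeE k'_eq freeX.
rewrite basisEfree freeX subvf dimvf dim_matrix mulr1 size_product_eigenvectors k_eq k'_eq.
have size_eq p q : (p.+1 * q.+1 = 1 + (p + (q + p * q)))%N.
  by rewrite mulSn mulnS add1n !addSn addnA addnCA addnA.
by have := size_eq n.-1 n'.-1; rewrite !prednK // => -> /=.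
Qed.

End Family.

Theorem theorem2p8 (R : realType) (n n' : nat) (hn : (0 < n)%N)
    (hn' : (0 < n')%N) (M : 'M[R]_n) (M' : 'M[R]_n') (rho rho' : R)
    (M_ge0 : nonneg_mx M) (M'_ge0 : nonneg_mx M')
    (M_irr : irreducible_mx M) (M'_irr : irreducible_mx M')
    (rho_ge0 : 0 <= rho) (rho'_ge0 : 0 <= rho')
    (M1 : M *m ones n = rho *: ones n)
    (M'1 : M' *m ones n' = rho' *: ones n')
    (k k' : nat)
    (lam : 'I_k.+1 -> R[i]) (v : 'I_k.+1 -> 'cV[R[i]]_n)
    (lam' : 'I_k'.+1 -> R[i]) (v' : 'I_k'.+1 -> 'cV[R[i]]_n')
    (v_first : v ord0 = ones n) (v'_first : v' ord0 = ones n')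
    (v_eig : forall i, is_eigenvector (complex_mx M) (lam i) (v i))
    (v'_eig : forall j, is_eigenvector (complex_mx M') (lam' j) (v' j))
    (v_free : free [seq v i | i : 'I_k.+1])
    (v'_free : free [seq v' j | j : 'I_k'.+1]) :
  let P := kron_sum M M' in
  let r := n%:R * rho' + n'%:R * rho in
  (is_spectral_radius P r /\
   is_eigenvector (complex_mx P) r%:C (kronv (ones n) (ones n')))
  /\
  (forall i : 'I_k.+1, i != ord0 ->
     gamma_den n n' rho rho' (lam i) != 0 /\
     is_eigenvector (complex_mx P) (n'%:R * lam i)
       (lift_left n' rho rho' (lam i) (v i)))
  /\
  (forall j : 'I_k'.+1, j != ord0 ->
     gamma_den' n n' rho rho' (lam' j) != 0 /\
     is_eigenvector (complex_mx P) (n%:R * lam' j)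
       (lift_right n rho rho' (lam' j) (v' j)))
  /\
  (forall (z : 'I_n.-1 -> 'cV[R[i]]_n) (z' : 'I_n'.-1 -> 'cV[R[i]]_n'),
     (forall i, is_null_vector (allones n) (z i)) ->
     (forall j, is_null_vector (allones n') (z' j)) ->
     free [seq z i | i : 'I_n.-1] ->
     free [seq z' j | j : 'I_n'.-1] ->
     (forall i j, is_null_vector (complex_mx P) (kronv (z i) (z' j)))
     /\ free (product_eigenvectors rho rho' lam v lam' v' z z')
     /\ (basis_of fullv [seq v i | i : 'I_k.+1] ->
         basis_of fullv [seq v' j | j : 'I_k'.+1] ->
         basis_of fullv (product_eigenvectors rho rho' lam v lam' v' z z'))).
Proof.
have v_line i : i != ord0 -> v i \notin <[ones n]>%VS.
  case: (unliftP ord0 i) => [j -> _|->]; last by rewrite eqxx.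
  have := v_free; rewrite image_ord_recl v_first => /free_cons_notin_line; apply.
  exact: image_f.
have v'_line j : j != ord0 -> v' j \notin <[ones n']>%VS.
  case: (unliftP ord0 j) => [i -> _|->]; last by rewrite eqxx.
  have := v'_free; rewrite image_ord_recl v'_first => /free_cons_notin_line; apply.
  exact: image_f.
have P1 := kron_sum_ones M1 M'1.
have nn'_gt0 : (0 < n * n')%N by rewrite muln_gt0 hn.
have P_ge0 : nonneg_mx (kron_sum M M').
  by move=> i j; rewrite !mxE mulr1 mul1r addr_ge0.
move=> P r; split; [split | split; [|split]].
- exact: spectral_radius_row_sum.
- rewrite kronv_ones; split; [exact: ones_neq0 | exact: complex_eigen_ones].
- move=> i i_neq0.
  have den : gamma_den n n' rho rho' (lam i) != 0.
    by apply: gamma_den_neq0 (v_eig i) (v_line i i_neq0).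
  split=> //; apply: lift_left_eigenvector => //; first exact: v_line.
  by case: (v_eig i).
- move=> j j_neq0.
  have den : gamma_den' n n' rho rho' (lam' j) != 0.
    (* [gamma_den'] is [gamma_den] with the two factors exchanged. *)
    by apply: (gamma_den_neq0 (n := n')) (v'_eig j) (v'_line j j_neq0).
  split=> //; apply: lift_right_eigenvector => //; first exact: v'_line.
  by case: (v'_eig j).
move=> z z' z_null z'_null z_free z'_free.
have freeX : free (product_eigenvectors rho rho' lam v lam' v' z z').
  by apply: free_product_eigenvectors => // [i|j]; [case: (z_null i) | case: (z'_null j)].
split; first by move=> i j; apply: kron_sum_null.
by split=> // *; apply: basis_product_eigenvectors.
Qed.
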